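(* Let $d \geq 1$, let $M \in \mathbb{R}^{d \times d}$ be an arbitrary matrix, let $R \geq 0$ be a real number, and let $\mathcal{X} \subset \mathbb{R}^d$ be such that $\|x\|_2 \leq R$ for all $x \in \mathcal{X}$. Then the bilinear similarity $$d_M : \mathcal{X}^2 \to \mathbb{R}, \qquad d_M(x_1,x_2) = x_1^T M x_2,$$ is $k$-lipschitz with respect to the norm $\|\cdot\|_2$, with $k = \sqrt{2}\,\|M\|_2\, R$.
   Context: A function $f : \mathcal{X}^2 \subset \mathbb{R}^d \times \mathbb{R}^d \to \mathbb{R}$ is said to be $k$-lipschitz with respect to the norm $\|\cdot\|_2$ if for all $(x_1,x_2,x_1',x_2') \in \mathcal{X}^4$, $$|f(x_1,x_2) - f(x_1',x_2')| \leq k \left\| \begin{pmatrix} x_1 \\ x_2 \end{pmatrix} - \begin{pmatrix} x_1' \\ x_2' \end{pmatrix} \right\|_2,$$ where $\begin{pmatrix} x_1 \\ x_2 \end{pmatrix} \in \mathbb{R}^{2d}$ denotes the concatenation of $x_1$ and $x_2$. For vectors, $\|\cdot\|_2$ is the Euclidean norm; for matrices, $\|\cdot\|_2$ is the induced operator (spectral) norm. *)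

(* Defs.v *)
From mathcomp Require Import all_boot all_order all_algebra.
From mathcomp Require Import classical_sets reals.

Set Implicit Arguments.
Unset Strict Implicit.
Unset Printing Implicit Defensive.

Import Order.TTheory GRing.Theory Num.Theory.

Local Open Scope classical_set_scope.
Local Open Scope ring_scope.

(* The norm that MathComp-Analysis puts on matrices is the max norm, and its
   Lipschitz notions are stated for that norm; the Euclidean versions are
   therefore defined here. *)
Definition norm2 (R : realType) (n : nat) (x : 'cV[R]_n) : R :=
  Num.sqrt (\sum_(i < n) x i 0 ^+ 2).

(* The set is nonempty (it contains 0) and bounded, so that [sup] is a genuine
   least upper bound here. *)
Definition opnorm2 (R : realType) (m n : nat) (A : 'M[R]_(m, n)) : R :=
  sup [set norm2 (A *m x) | x in [set x : 'cV[R]_n | norm2 x <= 1]].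

(* [f] stands for a function on [X * X]: its values elsewhere are ignored. *)
Definition lipschitz2 (R : realType) (d : nat) (X : set 'cV[R]_d) (k : R)
    (f : 'cV[R]_d -> 'cV[R]_d -> R) : Prop :=
  forall x1 x2 x1' x2' : 'cV[R]_d, X x1 -> X x2 -> X x1' -> X x2' ->
    `|f x1 x2 - f x1' x2'| <= k * norm2 (col_mx x1 x2 - col_mx x1' x2').

Definition bilinear_sim (R : realType) (d : nat) (M : 'M[R]_d)
    (x1 x2 : 'cV[R]_d) : R :=
  (x1^T *m M *m x2) 0 0.

(* Main.v *)
Require Import Defs.
From mathcomp Require Import all_boot all_order all_algebra.
From mathcomp Require Import classical_sets reals.
From mathcomp Require Import ring lra.

Import Order.TTheory GRing.Theory Num.Theory.

Local Open Scope ring_scope.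

(** Changing one argument of the bilinear form at a time gives, with
    [a := x1 - x1'] and [b := x2 - x2'],
      [x1^T M x2 - x1'^T M x2' = x1^T (M b) + a^T (M x2')].
    By Cauchy-Schwarz ([norm_dot_le]) and the operator norm bound
    ([norm2_mulmx_le]) the right-hand side is at most [r ||M|| (||b|| + ||a||)].
    The constant [sqrt 2] is the price of passing from [||a|| + ||b||] to the
    Euclidean norm of the concatenation of [a] and [b]. The matrix always acts
    on the second argument, so the norm of its transpose never comes in.

    Since [opnorm2] is a supremum, bounding [||A x||] by it takes a proof that
    the image of the unit ball is bounded ([norm2_mulmx_frobenius] gives one). *)

Lemma norm2_ge0 (R : realType) n (x : 'cV[R]_n) : 0 <= norm2 x.
Proof. exact: sqrtr_ge0. Qed.

Lemma sqr_norm2 (R : realType) n (x : 'cV[R]_n) :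
  norm2 x ^+ 2 = \sum_(i < n) x i 0 ^+ 2.
Proof. by rewrite sqr_sqrtr // sumr_ge0 // => i _; exact: sqr_ge0. Qed.

Lemma norm2Z (R : realType) n (c : R) (x : 'cV[R]_n) :
  norm2 (c *: x) = `|c| * norm2 x.
Proof.
rewrite /norm2 -sqrtr_sqr -sqrtrM ?sqr_ge0 // mulr_sumr.
by congr Num.sqrt; apply: eq_bigr => i _; rewrite mxE exprMn.
Qed.

Lemma norm2_eq0 (R : realType) n (x : 'cV[R]_n) : norm2 x = 0 -> x = 0.
Proof.
move=> x0; have /eqP := sqr_norm2 _ _ x.
rewrite x0 expr0n eq_sym psumr_eq0 => [/allP xi0|i _]; last exact: sqr_ge0.
apply/matrixP => i j; rewrite ord1 mxE.
by apply/eqP; rewrite -sqrf_eq0; exact: xi0 (mem_index_enum i).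
Qed.

Lemma sqr_norm2_col_mx (R : realType) m n (x : 'cV[R]_m) (y : 'cV[R]_n) :
  norm2 (col_mx x y) ^+ 2 = norm2 x ^+ 2 + norm2 y ^+ 2.
Proof.
rewrite !sqr_norm2 big_split_ord /=.
by congr (_ + _); apply: eq_bigr => i _; rewrite ?col_mxEu ?col_mxEd.
Qed.

(** Lagrange's identity: twice the difference of the two sides is the sum of
    the squares of all the [x i * y j - x j * y i]. *)
Lemma sqr_sum_mul_le (R : realDomainType) (I : finType) (x y : I -> R) :
  (\sum_i x i * y i) ^+ 2 <= (\sum_i x i ^+ 2) * (\sum_i y i ^+ 2).
Proof.
set S := \sum_i x i * y i; set X := \sum_i x i ^+ 2; set Y := \sum_i y i ^+ 2.
have lagrange :
    \sum_i \sum_j (x i * y j - x j * y i) ^+ 2 = (X * Y - S ^+ 2) *+ 2.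
  have inner i : \sum_j (x i * y j - x j * y i) ^+ 2 =
      x i ^+ 2 * Y + y i ^+ 2 * X - x i * y i *+ 2 * S.
    rewrite /Y /X /S !mulr_sumr -big_split -sumrB /=.
    by apply: eq_bigr => j _; ring.
  under eq_bigr => i _ do rewrite inner.
  by rewrite sumrB big_split /= -!mulr_suml sumrMnl -/X -/Y -/S; ring.
have: 0 <= (X * Y - S ^+ 2) *+ 2.
  by rewrite -lagrange; do 2!(apply: sumr_ge0 => ? _); exact: sqr_ge0.
by rewrite pmulrn_lge0 // subr_ge0.
Qed.

Lemma norm_dot_le (R : realType) n (x y : 'cV[R]_n) :
  `|(x^T *m y) 0 0| <= norm2 x * norm2 y.
Proof.
rewrite -(ler_pXn2r (isT : (0 < 2)%N)) ?nnegrE ?mulr_ge0 ?norm2_ge0 //.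
rewrite real_normK ?num_real // exprMn !sqr_norm2 mxE.
under eq_bigr => i _ do rewrite mxE.
exact: sqr_sum_mul_le.
Qed.

(** The operator norm is at most the Frobenius norm; only the finiteness of
    this bound matters, as it makes [opnorm2] an upper bound. *)
Lemma norm2_mulmx_frobenius (R : realType) m n (A : 'M[R]_(m, n))
    (x : 'cV[R]_n) :
  norm2 (A *m x) <= Num.sqrt (\sum_i \sum_j A i j ^+ 2) * norm2 x.
Proof.
have F0 : 0 <= \sum_i \sum_j A i j ^+ 2.
  by do 2!(apply: sumr_ge0 => ? _); exact: sqr_ge0.
rewrite -(ler_pXn2r (isT : (0 < 2)%N)) ?nnegrE ?mulr_ge0 ?norm2_ge0 ?sqrtr_ge0 //.
rewrite exprMn !sqr_norm2 sqr_sqrtr // mulr_suml.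
by apply: ler_sum => i _; rewrite mxE; exact: sqr_sum_mul_le.
Qed.

Lemma norm2_mulmx_le_opnorm2 (R : realType) m n (A : 'M[R]_(m, n))
    (x : 'cV[R]_n) :
  norm2 x <= 1 -> norm2 (A *m x) <= opnorm2 A.
Proof.
move=> x1; apply: ub_le_sup; last by exists x.
exists (Num.sqrt (\sum_i \sum_j A i j ^+ 2)) => _ [y /= y1 <-].
apply: le_trans (norm2_mulmx_frobenius _ _ _ A y) _.
by rewrite ler_piMr ?sqrtr_ge0.
Qed.

(** By homogeneity: a nonzero [x] is rescaled into the unit ball, where the
    supremum applies. *)
Lemma norm2_mulmx_le (R : realType) m n (A : 'M[R]_(m, n)) (x : 'cV[R]_n) :
  norm2 (A *m x) <= opnorm2 A * norm2 x.
Proof.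
have [x0|x_neq0] := eqVneq (norm2 x) 0.
  rewrite x0 mulr0 (norm2_eq0 _ _ _ x0) mulmx0.
  by rewrite -(scale0r (0 : 'cV_m)) norm2Z normr0 mul0r.
have x_gt0 : 0 < norm2 x by rewrite lt_neqAle eq_sym x_neq0 norm2_ge0.
have inv_norm : `|(norm2 x)^-1| = (norm2 x)^-1.
  by rewrite ger0_norm // invr_ge0 norm2_ge0.
rewrite -ler_pdivrMr // mulrC -{1}inv_norm -norm2Z scalemxAr.
by apply: norm2_mulmx_le_opnorm2; rewrite norm2Z inv_norm mulVf.
Qed.

Lemma opnorm2_ge0 (R : realType) m n (A : 'M[R]_(m, n)) : 0 <= opnorm2 A.
Proof.
apply: le_trans (norm2_ge0 _ _ (A *m 0)) (norm2_mulmx_le_opnorm2 _ _ _ A 0 _).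
by rewrite -(scale0r (0 : 'cV_n)) norm2Z normr0 mul0r.
Qed.

Lemma norm_bilinear_sim_le (R : realType) d (M : 'M[R]_d) (x y : 'cV[R]_d) :
  `|bilinear_sim M x y| <= opnorm2 M * norm2 x * norm2 y.
Proof.
rewrite /bilinear_sim -mulmxA; apply: le_trans (norm_dot_le _ _ _ _) _.
by rewrite mulrAC mulrC ler_wpM2r ?norm2_ge0 ?norm2_mulmx_le.
Qed.

Lemma bilinear_simB (R : realType) d (M : 'M[R]_d) (x y x' y' : 'cV[R]_d) :
  bilinear_sim M x y - bilinear_sim M x' y' =
  bilinear_sim M x (y - y') + bilinear_sim M (x - x') y'.
Proof.
by rewrite /bilinear_sim mulmxBr [(x - x')^T]linearB !mulmxBl !mxE addrA subrK.
Qed.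

(** Squared, the claim is [(a + b)^2 <= 2 (a^2 + b^2)], that is,
    [0 <= (a - b)^2] for the norms [a] and [b]. *)
Lemma norm2D_le_col_mx (R : realType) m n (x : 'cV[R]_m) (y : 'cV[R]_n) :
  norm2 x + norm2 y <= Num.sqrt 2 * norm2 (col_mx x y).
Proof.
rewrite -(ler_pXn2r (isT : (0 < 2)%N)) ?nnegrE ?addr_ge0 ?mulr_ge0 ?norm2_ge0
  ?sqrtr_ge0 //.
rewrite exprMn sqr_norm2_col_mx sqr_sqrtr ?ler0n //.
have := sqr_ge0 (norm2 x - norm2 y); lra.
Qed.

Theorem lemma2p2 (R : realType) (d : nat) (hd : (1 <= d)%N) (M : 'M[R]_d)
    (r : R) (hr : 0 <= r) (X : set 'cV[R]_d)
    (hX : forall x : 'cV[R]_d, X x -> norm2 x <= r) :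
  lipschitz2 X (Num.sqrt 2 * opnorm2 M * r) (bilinear_sim M).
Proof.
move=> x1 x2 x1' x2' X1 _ _ X2'.
rewrite opp_col_mx add_col_mx bilinear_simB.
set a := x1 - x1'; set b := x2 - x2'.
have Mr0 : 0 <= opnorm2 M * r by rewrite mulr_ge0 ?opnorm2_ge0.
have hb : `|bilinear_sim M x1 b| <= opnorm2 M * r * norm2 b.
  apply: le_trans (norm_bilinear_sim_le _ _ _ _ _) _.
  by rewrite ler_wpM2r ?norm2_ge0 // ler_wpM2l ?opnorm2_ge0 // hX.
have ha : `|bilinear_sim M a x2'| <= opnorm2 M * r * norm2 a.
  apply: le_trans (norm_bilinear_sim_le _ _ _ _ _) _.
  by rewrite mulrAC ler_wpM2r ?norm2_ge0 // ler_wpM2l ?opnorm2_ge0 // hX.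
apply: le_trans (ler_normD _ _) _; apply: le_trans (lerD hb ha) _.
rewrite -mulrDr addrC.
have -> : Num.sqrt 2 * opnorm2 M * r * norm2 (col_mx a b) =
    opnorm2 M * r * (Num.sqrt 2 * norm2 (col_mx a b)) by ring.
by rewrite ler_wpM2l // norm2D_le_col_mx.
Qed.
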